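(* Let $H$ be a separable real Hilbert space with inner product $\langle\cdot,\cdot\rangle$, let $(\Omega,\mathscr{F},\mathbb{P})$ be a complete probability space, and let $\xi:\Omega\to H$ be a centered random element in $H$ of strong second order, with covariance operator $R$. Let $(\lambda_j: j\in J)$ be the (possibly finite) non-increasing sequence of nonzero eigenvalues of $R$, repeated according to multiplicity, and let $\{\varphi_j: j\in J\}$ denote the orthonormal set of associated eigenvectors, so $R(\varphi_j)=\lambda_j\varphi_j$. Then: (i) $\xi(\omega)=\sum_{j\in J}\langle\xi(\omega),\varphi_j\rangle\varphi_j$ in $H$, for almost every $\omega$; (ii) $\xi=\sum_{j\in J}\langle\xi,\varphi_j\rangle\varphi_j$ in $L^2_{\mathbb{P}}(H)$. Moreover, the scalar random variables $\langle\xi,\varphi_i\rangle$ and $\langle\xi,\varphi_j\rangle$ are uncorrelated if $i\neq j$, and $\mathbb{E}\langle\xi,\varphi_j\rangle^2=\lambda_j$ for every $j\in J$.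
   Context: A random element in a separable Hilbert space $H$ is a Borel measurable map $\xi:\Omega\to H$. It is of strong second order, written $\xi\in L^2_{\mathbb{P}}(H)$, if $\mathbb{E}\|\xi\|^2<\infty$; convergence in $L^2_{\mathbb{P}}(H)$ means convergence in the norm $(\mathbb{E}\|\cdot\|^2)^{1/2}$. The expectation $\mathbb{E}\xi$ is the unique element of $H$ with $\mathbb{E}\langle\xi,f\rangle=\langle\mathbb{E}\xi,f\rangle$ for all $f\in H$, and $\xi$ is centered if $\mathbb{E}\xi=0$. The covariance operator of $\xi\in L^2_{\mathbb{P}}(H)$ is the (nuclear) operator $R(h):=\mathbb{E}\big[\langle\xi,h\rangle\xi\big]$, $h\in H$. The index set is $J=\{1,\dots,d\}$ if $R$ has finite rank $d$, and $J=\mathbb{N}$ otherwise. *)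

(* Defs.v *)
From mathcomp Require Import all_boot all_order all_algebra.
From mathcomp Require Import sesquilinear.
From mathcomp Require Import all_classical all_reals all_analysis.

Set Implicit Arguments.
Unset Strict Implicit.
Unset Printing Implicit Defensive.

Import Order.TTheory GRing.Theory Num.Theory.
Import numFieldNormedType.Exports.

Local Open Scope classical_set_scope.
Local Open Scope ring_scope.

Definition separable_space (T : topologicalType) : Prop :=
  exists2 D : set T, countable D & dense D.

(* A real Hilbert space is a complete normed module [H] together with an inner
   product, i.e. a symmetric positive definite bilinear form
   [dot : {dot H for idfun}], which induces the norm of [H]. *)
Definition induces_norm (R : realType) (H : normedModType R)
  (dot : {dot H for idfun}) : Prop :=
  forall x : H, dot x x = `|x| ^+ 2.

Definition random_element (R : realType) (H : normedModType R)
  (d : measure_display) (T : measurableType d) (X : T -> H) : Prop :=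
  measurable_fun setT (X : T -> g_sigma_algebraType (@open H)).

Definition strong_second_order (R : realType) (H : normedModType R)
  (d : measure_display) (T : measurableType d) (P : probability T R)
  (X : T -> H) : Prop :=
  random_element X /\ ('E_P[fun w => (`|X w| ^+ 2)%R] < +oo)%E.

Definition L2norm (R : realType) (H : normedModType R)
  (d : measure_display) (T : measurableType d) (P : probability T R)
  (X : T -> H) : \bar R :=
  ('E_P[fun w => (`|X w| ^+ 2)%R] `^ (2^-1))%E.

Definition cvg_L2 (R : realType) (H : normedModType R)
  (d : measure_display) (T : measurableType d) (P : probability T R)
  (X_ : nat -> T -> H) (X : T -> H) : Prop :=
  [/\ forall n, strong_second_order P (X_ n),
      strong_second_order P X &
      L2norm P (fun w => X_ n w - X w) @[n --> \oo] --> 0%E].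

(* Equality with a finite number entails that [dot (X w) f] is integrable
   whenever it is measurable. *)
Definition is_mean (R : realType) (H : normedModType R)
  (dot : {dot H for idfun}) (d : measure_display) (T : measurableType d)
  (P : probability T R) (X : T -> H) (m : H) : Prop :=
  forall f : H, ('E_P[fun w => dot (X w) f] = (dot m f)%:E)%E.

Definition centered (R : realType) (H : normedModType R)
  (dot : {dot H for idfun}) (d : measure_display) (T : measurableType d)
  (P : probability T R) (X : T -> H) : Prop :=
  is_mean dot P X 0.

(* The element characterized by [is_mean]; the default value 0 is only
   returned when there is no such element, which cannot happen when [X] is a
   random element of a Hilbert space with integrable norm. *)
Definition mean (R : realType) (H : normedModType R)
  (dot : {dot H for idfun}) (d : measure_display) (T : measurableType d)
  (P : probability T R) (X : T -> H) : H :=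
  xget 0 [set m | is_mean dot P X m].

Definition covariance_operator (R : realType) (H : normedModType R)
  (dot : {dot H for idfun}) (d : measure_display) (T : measurableType d)
  (P : probability T R) (X : T -> H) (h : H) : H :=
  mean dot P (fun w => dot (X w) h *: X w).

Definition has_dim (R : realType) (H : lmodType R) (E : set H) (n : nat) :
    Prop :=
  exists e : 'I_n -> H,
    (forall c : 'I_n -> R, \sum_i c i *: e i = 0 -> forall i, c i = 0) /\
    E = [set x | exists c : 'I_n -> R, x = \sum_i c i *: e i].

Definition eigenspace_of (R : realType) (H : lmodType R) (A : H -> H)
  (mu : R) : set H := [set h | A h = mu *: h].

(* Indices start at 0: this is {0, ..., d - 1} if the range of [A] has finite
   dimension d, and all of nat if it is infinite dimensional. *)
Definition index_set (R : realType) (H : lmodType R) (A : H -> H) : set nat :=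
  [set j | forall d : nat, has_dim (range A) d -> (j < d)%N].

(* Only the values of [lam] and [phi] on [index_set A] matter.  The last clause
   says that each nonzero number, as an eigenvalue of [A], is listed as many
   times as the dimension of its eigenspace (not at all if it is not an
   eigenvalue); finiteness of the multiplicities is not assumed. *)
Definition eigenvalue_sequence (R : realType) (H : lmodType R) (A : H -> H)
  (lam : nat -> R) : Prop :=
  let J := index_set A in
  [/\ forall j, J j -> lam j != 0,
      forall i j, J i -> J j -> (i <= j)%N -> lam j <= lam i &
      forall (mu : R) (n : nat), mu != 0 ->
        has_dim (eigenspace_of A mu) n <->
        ([set j | J j /\ lam j = mu] #= `I_n)%card].

Definition orthonormal_eigenvectors (R : realType) (H : normedModType R)
  (dot : {dot H for idfun}) (A : H -> H) (lam : nat -> R) (phi : nat -> H) :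
    Prop :=
  let J := index_set A in
  (forall i j, J i -> J j -> dot (phi i) (phi j) = (i == j)%:R) /\
  (forall j, J j -> A (phi j) = lam j *: phi j).

Definition partial_expansion (R : realType) (H : normedModType R)
  (dot : {dot H for idfun}) (J : set nat) (phi : nat -> H) (n : nat) (x : H) :
    H :=
  \sum_(0 <= j < n | j \in J) dot x (phi j) *: phi j.

(* Main.v *)
Require Import Defs.
From mathcomp Require Import all_boot all_order all_algebra.
From mathcomp Require Import sesquilinear.
From mathcomp Require Import all_classical all_reals all_analysis.
From mathcomp Require Import measurable_realfun ring lra.
Set Implicit Arguments.
Unset Strict Implicit.
Unset Printing Implicit Defensive.
Import Order.TTheory GRing.Theory Num.Theory.
Import numFieldNormedType.Exports.
Local Open Scope classical_set_scope.
Local Open Scope ring_scope.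

(** The covariance operator A of xi, characterized by
    E <xi, x> <xi, y> = <A x, y> ([covariance_operatorE]), is symmetric and
    positive. It also has finite trace: taking expectations in Bessel's
    inequality bounds the sum of the <A e_i, e_i> by E |xi|^2 for every finite
    orthonormal family ([covariance_operator_trace]). The characterization gives
    at once that the coefficients <xi, phi_j> are uncorrelated with variances
    lam_j.

    The expansion rests on one fact: <A x, x> = E <xi, x>^2 vanishes for every x
    orthogonal to all the phi_j ([form_eq0_on_complement]). These x form a
    closed subspace M invariant under A. If the form were not 0 on M, then A
    would have an eigenvector in M with an eigenvalue mu > 0
    ([exists_eigenvector]); but mu has finite multiplicity because of the trace,
    and as many phi_j as this multiplicity are listed for mu, so that they span
    the eigenspace and leave no room for a vector orthogonal to them
    ([no_eigenvector_orthogonal]).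

    The eigenvector is found at the supremum s of <A x, x> over the unit sphere
    of M. A maximizing sequence u_n satisfies A u_n - s u_n -> 0. The trace bound
    provides finitely many vectors off the span of which the form is at most
    (s / 2) |x|^2, where A - s is therefore bounded below
    ([norm_le_op_shift]). So u_n converges along any ultrafilter along which its
    finitely many coordinates on these vectors converge
    ([eigenvector_of_maximizing]).

    Now let S x be the sum of the <x, phi_j> phi_j. Since x - S x lies in M,
    <xi - S xi, x> = <xi, x - S x> vanishes almost surely, for each x and hence
    simultaneously for all x of a countable dense set; thus xi = S xi almost
    surely ([ae_cvg_partial_expansion]). Convergence in mean square follows by
    dominated convergence ([cvg_L2_partial_expansion]). *)

(** * Inner products and orthonormal expansions *)

Section inner_product.
Context (R : realType) (H : normedModType R) (dot : {dot H for idfun}).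
Hypothesis Hdot : induces_norm dot.
Implicit Types x y z : H.

Lemma dotC x y : dot x y = dot y x.
Proof. by rewrite hermC expr0 mul1r. Qed.

Lemma dotDl x y z : dot (x + y) z = dot x z + dot y z.
Proof. exact: linearDl. Qed.

Lemma dotBl x y z : dot (x - y) z = dot x z - dot y z.
Proof. exact: linearBl. Qed.

Lemma dotZl a x y : dot (a *: x) y = a * dot x y.
Proof. exact: linearZl_LR. Qed.

Lemma dotDr x y z : dot x (y + z) = dot x y + dot x z.
Proof. exact: linearDr. Qed.

Lemma dotBr x y z : dot x (y - z) = dot x y - dot x z.
Proof. exact: linearBr. Qed.

Lemma dotZr a x y : dot x (a *: y) = a * dot x y.
Proof. by rewrite dotC dotZl dotC. Qed.

Lemma dot0l x : dot 0 x = 0.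
Proof. exact: linear0l. Qed.

Lemma dot0r x : dot x 0 = 0.
Proof. exact: linear0r. Qed.

Lemma dot_suml I r (Q : pred I) (F : I -> H) y :
  dot (\sum_(i <- r | Q i) F i) y = \sum_(i <- r | Q i) dot (F i) y.
Proof. exact: linear_sumlz. Qed.

Lemma dot_sumr I r (Q : pred I) (F : I -> H) y :
  dot y (\sum_(i <- r | Q i) F i) = \sum_(i <- r | Q i) dot y (F i).
Proof. exact: linear_sumr. Qed.

Lemma sqr_normD x y : `|x + y| ^+ 2 = `|x| ^+ 2 + 2 * dot x y + `|y| ^+ 2.
Proof. rewrite -!Hdot dotDl !dotDr (dotC y x); ring. Qed.

Lemma sqr_normB x y : `|x - y| ^+ 2 = `|x| ^+ 2 - 2 * dot x y + `|y| ^+ 2.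
Proof. rewrite -!Hdot dotBl !dotBr (dotC y x); ring. Qed.

Lemma dot_eq0 x : (forall y, dot x y = 0) -> x = 0.
Proof.
by move=> /(_ x); rewrite Hdot => /eqP; rewrite sqrf_eq0 normr_eq0 => /eqP.
Qed.

(** The common core of the Cauchy-Schwarz inequality for the inner product, of
    the one for the form of a positive operator, and of the first-order
    condition in the Riesz representation theorem. *)
Lemma nonneg_quadratic_discr (a b c : R) : 0 <= c ->
  (forall t, 0 <= a + 2 * t * b + t ^+ 2 * c) -> b ^+ 2 <= a * c.
Proof.
rewrite le_eqVlt => /predU1P[<-|c0] abc; last first.
  have := abc (- (b / c)).
  have -> : a + 2 * - (b / c) * b + (- (b / c)) ^+ 2 * c = (a * c - b ^+ 2) / c.
    by field; rewrite gt_eqF.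
  by rewrite pmulr_lge0 ?invr_gt0// subr_ge0.
have [->|b0] := eqVneq b 0; first by rewrite expr0n/= mulr0.
(* Here c = 0, and this t makes the affine function a + 2 t b equal to -1. *)
have := abc (- ((a + 1) / (2 * b))).
have -> : 2 * - ((a + 1) / (2 * b)) * b = - (a + 1) by field.
rewrite mulr0; lra.
Qed.

Lemma sqr_dot_le x y : dot x y ^+ 2 <= `|x| ^+ 2 * `|y| ^+ 2.
Proof.
apply: nonneg_quadratic_discr => [|t]; first exact: sqr_ge0.
have -> : `|x| ^+ 2 + 2 * t * dot x y + t ^+ 2 * `|y| ^+ 2 = `|x + t *: y| ^+ 2.
  rewrite sqr_normD dotZr normrZ exprMn real_normK ?num_real//; ring.
exact: sqr_ge0.
Qed.

Lemma normr_dot_le x y : `|dot x y| <= `|x| * `|y|.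
Proof.
rewrite -ler_sqr ?nnegrE ?mulr_ge0// real_normK ?num_real// exprMn.
exact: sqr_dot_le.
Qed.

Lemma continuous_dot y : continuous (fun x => dot x y).
Proof.
move=> x; apply/cvgrPdist_lt => e e0.
have y0 : 0 < `|y| + 1 by rewrite ltr_wpDl.
near=> z; rewrite -dotBl (le_lt_trans (normr_dot_le _ _))//.
rewrite (@le_lt_trans _ _ (`|x - z| * (`|y| + 1)))//.
  by rewrite ler_wpM2l// lerDl.
rewrite -ltr_pdivlMr//; near: z.
exact: (cvgrPdist_lt _ _).1 (@cvg_id _ (nbhs x)) _ (divr_gt0 e0 y0).
Unshelve. all: by end_near. Qed.

Lemma cvg_dot (U : Type) (F : set_system U) {FF : Filter F} (f : U -> H) l y :
  f x @[x --> F] --> l -> dot (f x) y @[x --> F] --> dot l y.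
Proof. by move=> fl; exact: continuous_cvg (@continuous_dot y l) fl. Qed.

(** Relative to an index set, because the eigenvectors are only constrained on
    the index set of the operator; a finite family is the case J = `I_N. *)
Definition orthonormal_on (J : set nat) (e : nat -> H) :=
  forall i j, J i -> J j -> dot (e i) (e j) = (i == j)%:R.

Section partial_expansion.
Variables (J : set nat) (e : nat -> H).
Local Notation S := (partial_expansion dot J e).

Lemma partial_expansionB n x y : S n (x - y) = S n x - S n y.
Proof.
rewrite /partial_expansion -sumrB; apply: eq_bigr => i _.
by rewrite dotBl scalerBl.
Qed.

Lemma partial_expansion_sym n x y : dot (S n x) y = dot x (S n y).
Proof.
rewrite dot_suml dot_sumr; apply: eq_bigr => i _.
by rewrite dotZl dotZr (dotC y) mulrC.
Qed.

Lemma dot_partial_expansion n x :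
  dot x (S n x) = \sum_(0 <= j < n | j \in J) dot x (e j) ^+ 2.
Proof. by rewrite dot_sumr; apply: eq_bigr => i _; rewrite dotZr expr2. Qed.

Hypothesis oe : orthonormal_on J e.

Lemma partial_expansion_coef n x i : J i -> (i < n)%N ->
  dot (S n x) (e i) = dot x (e i).
Proof.
move=> Ji ni; rewrite dot_suml big_mkord.
rewrite (bigD1 (Ordinal ni)) ?inE//= dotZl oe// eqxx mulr1.
rewrite big1 ?addr0// => j /andP[/set_mem Jj ji].
by rewrite dotZl oe// (_ : (j == i :> nat) = false) ?mulr0//; exact/negbTE.
Qed.

Lemma partial_expansion_comp m n x : (m <= n)%N -> S m (S n x) = S m x.
Proof.
move=> mn; rewrite /partial_expansion big_nat_cond [RHS]big_nat_cond.
apply: eq_bigr => i /andP[/andP[_ im] /set_mem Ji].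
by rewrite -/(S n x) partial_expansion_coef// (leq_trans im).
Qed.

Lemma sqr_norm_partial_expansion n x : `|S n x| ^+ 2 = dot x (S n x).
Proof. by rewrite -Hdot partial_expansion_sym partial_expansion_comp. Qed.

Lemma sqr_norm_partial_expansionB m n x : (m <= n)%N ->
  `|S m x - S n x| ^+ 2 = dot x (S n x) - dot x (S m x).
Proof.
move=> mn; rewrite sqr_normB !sqr_norm_partial_expansion.
rewrite (dotC (S m x)) partial_expansion_sym -[X in 2 * X]partial_expansion_sym.
rewrite [dot (S n x) _]dotC partial_expansion_sym partial_expansion_comp//; ring.
Qed.

Lemma sqr_norm_subr_partial_expansion n x :
  `|x - S n x| ^+ 2 = `|x| ^+ 2 - dot x (S n x).
Proof. rewrite sqr_normB sqr_norm_partial_expansion; ring. Qed.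

Lemma bessel_inequality n x : dot x (S n x) <= `|x| ^+ 2.
Proof. by rewrite -subr_ge0 -sqr_norm_subr_partial_expansion sqr_ge0. Qed.

Lemma norm_partial_expansion_le n x : `|S n x| <= `|x|.
Proof.
by rewrite -ler_sqr ?nnegrE// sqr_norm_partial_expansion bessel_inequality.
Qed.

End partial_expansion.
End inner_product.

Section expansion.
Context (R : realType) (H : completeNormedModType R) (dot : {dot H for idfun}).
Hypothesis Hdot : induces_norm dot.
Variables (J : set nat) (e : nat -> H).
Hypothesis oe : orthonormal_on dot J e.
Local Notation S := (partial_expansion dot J e).

(** The squared distance between two partial sums is the increment of
    [dot x (S n x)], which Bessel's inequality bounds: close to the supremum of
    these numbers, the partial sums are close to each other. *)
Lemma is_cvg_partial_expansion x : cvg (S n x @[n --> \oo]).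
Proof.
apply: cauchy_cvg; apply: cauchy_exP => eps eps0.
pose a n := dot x (S n x).
have sa : has_sup (range a).
  split; first by exists (a 0), 0.
  by exists (`|x| ^+ 2) => _ [n _ <-]; exact: bessel_inequality.
have [_ [N _ <-] aN] := sup_adherent (exprn_gt0 2 eps0) sa.
exists (S N x).
suff : \forall n \near \oo, ball (S N x) eps (S n x) by [].
near=> n.
have Nn : (N <= n)%N by near: n; exact: nbhs_infty_ge.
rewrite -ball_normE/= -ltr_sqr ?nnegrE// ?ltW//.
rewrite (sqr_norm_partial_expansionB Hdot)//.
rewrite -/(a n) -/(a N).
have : a n <= sup (range a) by apply: sup_ubound; [case: sa|exists n].
lra.
Unshelve. all: by end_near. Qed.

Definition expansion x := lim (S n x @[n --> \oo]).

Lemma cvg_expansion x : S n x @[n --> \oo] --> expansion x.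
Proof. exact: is_cvg_partial_expansion. Qed.

Lemma expansion_sym x y : dot (expansion x) y = dot x (expansion y).
Proof.
have h1 : dot (S n x) y @[n --> \oo] --> dot (expansion x) y.
  by apply: cvg_dot => //; exact: cvg_expansion.
have h2 : dot (S n x) y @[n --> \oo] --> dot x (expansion y).
  under eq_fun do rewrite partial_expansion_sym dotC.
  by rewrite dotC; apply: cvg_dot => //; exact: cvg_expansion.
exact: cvg_unique h1 h2.
Qed.

Lemma expansion_coef x i : J i -> dot (expansion x) (e i) = dot x (e i).
Proof.
move=> Ji.
have h1 : dot (S n x) (e i) @[n --> \oo] --> dot (expansion x) (e i).
  by apply: cvg_dot => //; exact: cvg_expansion.
have h2 : dot (S n x) (e i) @[n --> \oo] --> dot x (e i).
  apply: cvg_near_cst; near=> n; apply: partial_expansion_coef => //.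
  by near: n; exact: nbhs_infty_gt.
exact: cvg_unique h1 h2.
Unshelve. all: by end_near. Qed.

End expansion.

(** * Maximizing sequences and the Riesz representation *)

Lemma sup_sequence (R : realType) (E : set R) : has_sup E ->
  exists u : nat -> R, (forall n, E (u n)) /\ (u n @[n --> \oo] --> sup E).
Proof.
move=> sE.
have /choice[u uE] : forall n : nat, exists x, E x /\ sup E - n.+1%:R^-1 < x.
  move=> n; have n0 : 0 < n.+1%:R^-1 :> R by rewrite invr_gt0.
  by have [x Ex xlt] := sup_adherent n0 sE; exists x.
exists u; split; first by move=> n; case: (uE n).
apply/cvgrPdist_lt => eps eps0; near=> n.
have [En un] := uE n.
have uns : u n <= sup E by apply: sup_ubound => //; case: sE.
have : n.+1%:R^-1 < eps by near: n; exact: (near_infty_natSinv_lt (PosNum eps0)).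
by apply: lt_trans; rewrite ger0_norm ?subr_ge0// ltrBlDl -ltrBlDr.
Unshelve. all: by end_near. Qed.

(** Ultrafilters replace the extraction of subsequences: any number of bounded
    real functions converge along the same one. *)
Lemma ultra_cvg_segment (R : realType) T (U : set_system T) (f : T -> R) a b :
  UltraFilter U -> (forall x, a <= f x <= b) ->
  exists l : R, f x @[x --> U] --> l.
Proof.
move=> UU fab.
have fU : U (f @^-1` `[a, b]%classic).
  by apply: filterE => x; rewrite /= in_itv/= fab.
have [l [_ cl]] := @segment_compact _ a b (f @ U) _ fU; exists l => B lB.
have [//|UB] := in_ultra_setVsetC (f @^-1` B) UU.
by have [y [nBy By]] := cl (~` B) B UB lB.
Qed.

Section riesz.
Context (R : realType) (H : completeNormedModType R) (dot : {dot H for idfun}).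
Hypothesis Hdot : induces_norm dot.

(** The representing vector is the maximizer of 2 l x - |x|^2. By the
    parallelogram identity a maximizing sequence is Cauchy, and at the maximum
    the derivative 2 (l x - dot m x) in each direction x vanishes. *)
Lemma riesz_representation (l : H -> R) (c : R) :
  (forall a x y, l (a *: x + y) = a * l x + l y) ->
  (forall x, `|l x| <= c * `|x|) ->
  exists m, forall x, l x = dot m x.
Proof.
move=> lin lc.
pose E := [set 2 * l x - `|x| ^+ 2 | x in [set: H]].
have E0 : has_sup E.
  split; first by exists (2 * l 0 - `|0 : H| ^+ 2), 0.
  exists (c ^+ 2) => _ [x _ <-].
  have := ler_norm (l x); have := lc x; have := sqr_ge0 (`|x| - c); nra.
have [v [Ev vE]] := sup_sequence E0.
have /choice[u uv] : forall n, exists x, v n = 2 * l x - `|x| ^+ 2.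
  by move=> n; have [x _ <-] := Ev n; exists x.
have Esup x : 2 * l x - `|x| ^+ 2 <= sup E.
  by apply: sup_ubound; [case: E0|exists x].
have par x y : `|x - y| ^+ 2 <=
    2 * (sup E - (2 * l x - `|x| ^+ 2)) + 2 * (sup E - (2 * l y - `|y| ^+ 2)).
  have := Esup (2^-1 *: x + 2^-1 *: y).
  rewrite lin -[2^-1 *: y]addr0 lin (_ : l 0 = 0); last first.
    by have := lin 1 0 0; rewrite scale1r addr0 mul1r; lra.
  rewrite addr0 -scalerDr normrZ exprMn (sqr_normD Hdot) (sqr_normB Hdot).
  rewrite real_normK ?num_real//; lra.
have cu : cvg (u n @[n --> \oo]).
  apply: cauchy_cvg; apply: cauchy_exP => eps eps0.
  have e4 : 0 < eps ^+ 2 / 4 by rewrite divr_gt0// exprn_gt0.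
  have : \forall n \near \oo, `|sup E - v n| < eps ^+ 2 / 4.
    exact: (cvgrPdist_lt _ _).1 vE _ e4.
  move=> [N _ HN].
  have HN' n : (N <= n)%N -> sup E - v n < eps ^+ 2 / 4.
    by move=> /HN; apply: le_lt_trans; exact: ler_norm.
  exists (u N).
  suff : \forall n \near \oo, ball (u N) eps (u n) by [].
  exists N => // n /= Nn.
  rewrite -ball_normE/= -ltr_sqr ?nnegrE// ?ltW//.
  apply: le_lt_trans (par _ _) _; rewrite -!uv.
  have := HN' _ (leqnn N); have := HN' _ Nn; lra.
set m := lim (u n @[n --> \oo]).
have um : u n @[n --> \oo] --> m by [].
have lB x y : l (x - y) = l x - l y.
  by rewrite addrC -scaleN1r lin mulN1r addrC.
have lm : l (u n) @[n --> \oo] --> l m.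
  apply/cvgrPdist_lt => eps eps0.
  have c0 : 0 < `|c| + 1 by rewrite ltr_wpDl.
  near=> n; rewrite -lB (le_lt_trans (lc _))//.
  rewrite (@le_lt_trans _ _ ((`|c| + 1) * `|m - u n|))//.
    by rewrite ler_wpM2r//; have := ler_norm c; lra.
  rewrite mulrC -ltr_pdivlMr//; near: n.
  exact: (cvgrPdist_lt _ _).1 um _ (divr_gt0 eps0 c0).
have mE : 2 * l m - `|m| ^+ 2 = sup E.
  suff : v n @[n --> \oo] --> 2 * l m - `|m| ^+ 2.
    by move=> h; exact: cvg_unique h vE.
  under eq_fun do rewrite uv expr2; rewrite expr2; apply: cvgB.
    exact: cvgMl_tmp.
  by apply: cvgM; exact: cvg_norm.
exists m => x; apply/eqP; rewrite -subr_eq0 -sqrf_eq0 eq_le sqr_ge0 andbT.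
rewrite -[leRHS](mul0r (`|x| ^+ 2)).
apply: nonneg_quadratic_discr => [|t]; first exact: sqr_ge0.
have := Esup (- t *: x + m).
rewrite -mE lin (addrC (- t *: x)) (sqr_normD Hdot) dotZr normrZ exprMn real_normK ?num_real//.
nra.
Unshelve. all: by end_near. Qed.

End riesz.

(** * Eigenvectors of positive operators of finite trace *)

Section positive_operator.
Context (R : realType) (H : completeNormedModType R) (dot : {dot H for idfun}).
Hypothesis Hdot : induces_norm dot.
Variable A : H -> H.
Hypothesis A_sym : forall x y, dot (A x) y = dot x (A y).
Hypothesis A_pos : forall x, 0 <= dot (A x) x.

Lemma symmetricD x y : A (x + y) = A x + A y.
Proof.
apply/eqP; rewrite -subr_eq0; apply/eqP; apply: (dot_eq0 Hdot) => z.
by rewrite dotBl dotDl !A_sym dotDl subrr.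
Qed.

Lemma symmetricZ a x : A (a *: x) = a *: A x.
Proof.
apply/eqP; rewrite -subr_eq0; apply/eqP; apply: (dot_eq0 Hdot) => z.
by rewrite dotBl dotZl !A_sym dotZl subrr.
Qed.

Lemma symmetricB x y : A (x - y) = A x - A y.
Proof. by rewrite symmetricD -scaleN1r symmetricZ scaleN1r. Qed.

(** Cauchy-Schwarz for the positive semidefinite form dot (A x) y. *)
Lemma sqr_dot_op_le x y :
  dot (A x) y ^+ 2 <= dot (A x) x * dot (A y) y.
Proof.
apply: nonneg_quadratic_discr => // t.
have := A_pos (x + t *: y).
rewrite symmetricD symmetricZ !dotDl !dotDr !dotZl !dotZr.
rewrite (_ : dot (A y) x = dot (A x) y); last by rewrite A_sym dotC.
by congr (_ <= _); ring.
Qed.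

Variable M : set H.
Hypothesis M_lin : forall a x y, M x -> M y -> M (a *: x + y).
Hypothesis M_closed : closed M.
Hypothesis M_inv : forall x, M x -> M (A x).

Lemma subspaceB x y : M x -> M y -> M (x - y).
Proof. by move=> Mx My; rewrite addrC -scaleN1r; exact: M_lin. Qed.

Lemma subspaceZ a x : M x -> M (a *: x).
Proof.
move=> Mx; rewrite -[_ *: _]addr0; apply: M_lin => //.
by rewrite -(subrr x); exact: subspaceB.
Qed.

Lemma subspace_partial_expansion N e x : M x -> (forall i, (i < N)%N -> M (e i)) ->
  M (partial_expansion dot `I_N e N x).
Proof.
move=> Mx Me; rewrite /partial_expansion big_nat_cond.
apply: big_ind => [|y z My Mz|i /andP[/andP[_ iN] _]].
- by rewrite -(subrr x); exact: subspaceB.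
- by rewrite -[y]scale1r; exact: M_lin.
- by apply: subspaceZ; exact: Me.
Qed.

Variable s : R.
Hypothesis s_gt0 : 0 < s.
Hypothesis A_le : forall x, M x -> dot (A x) x <= s * `|x| ^+ 2.

(** The case y = A x of Cauchy-Schwarz for the form of A, divided by
    |A x|^2. *)
Lemma sqr_norm_op_le x : M x -> `|A x| ^+ 2 <= s * dot (A x) x.
Proof.
move=> Mx; have := sqr_dot_op_le x (A x); rewrite Hdot.
have := A_le (M_inv Mx); have := A_pos x.
have := sqr_ge0 `|A x|; rewrite le_eqVlt => /predU1P[<- *|y0 x0 le2 le1].
  by rewrite mulr_ge0// ltW.
rewrite -(ler_pM2l y0) -expr2 (le_trans le1)//.
rewrite [leRHS](_ : _ = dot (A x) x * (s * `|A x| ^+ 2)); last by ring.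
exact: ler_wpM2l.
Qed.

Lemma norm_op_le x : M x -> `|A x| <= s * `|x|.
Proof.
move=> Mx; rewrite -ler_sqr ?nnegrE ?mulr_ge0 ?(ltW s_gt0)// exprMn.
rewrite (le_trans (sqr_norm_op_le Mx))// expr2 -mulrA ler_wpM2l ?(ltW s_gt0)//.
exact: A_le.
Qed.

(** A unit vector at which the form of A nearly reaches its bound s is nearly
    an eigenvector for s. *)
Lemma sqr_norm_op_shift_le x : M x ->
  `|A x - s *: x| ^+ 2 <= s * (s * `|x| ^+ 2 - dot (A x) x).
Proof.
move=> Mx; rewrite (sqr_normB Hdot) dotZr normrZ exprMn real_normK ?num_real//.
have := sqr_norm_op_le Mx; lra.
Qed.

Lemma norm_op_shift_le x : M x -> `|A x - s *: x| <= 2 * s * `|x|.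
Proof.
move=> Mx; rewrite (le_trans (ler_normB _ _))// normrZ gtr0_norm//.
have := norm_op_le Mx; lra.
Qed.

Variable C : R.
Hypothesis A_trace : forall N e, orthonormal_on dot `I_N e ->
  \sum_(i < N) dot (A (e i)) (e i) <= C.

(** This is where the trace bound acts as compactness of A. Vectors on which
    the form exceeds (s / 2) |x|^2 are collected greedily, each orthogonal to
    the previous ones; each adds s / 2 to the trace, so the process stops. *)
Lemma finite_dominant_family : exists N e,
  [/\ orthonormal_on dot `I_N e, forall i, (i < N)%N -> M (e i) &
    forall x, M x -> (forall i, (i < N)%N -> dot x (e i) = 0) ->
      dot (A x) x <= s / 2 * `|x| ^+ 2].
Proof.
apply: contrapT => nofam.
have fam N : exists e, [/\ orthonormal_on dot `I_N e,
    forall i, (i < N)%N -> M (e i) &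
    forall i, (i < N)%N -> s / 2 <= dot (A (e i)) (e i)].
  elim: N => [|N [e [oe Me le]]].
    by exists (fun=> 0); split.
  have [x [Mx xe xs]] : exists x, [/\ M x,
      forall i, (i < N)%N -> dot x (e i) = 0 & s / 2 * `|x| ^+ 2 < dot (A x) x].
    apply: contrapT => nox; apply: nofam; exists N, e; split => // x Mx xe.
    by rewrite leNgt; apply/negP => xs; apply: nox; exists x.
  have x0 : 0 < `|x|.
    rewrite normr_gt0; apply/eqP => x0; move: xs.
    by rewrite x0 dot0r normr0 expr0n/= mulr0 ltxx.
  pose y := `|x|^-1 *: x.
  have ye i : (i < N)%N -> dot y (e i) = 0 by move=> /xe; rewrite dotZl => ->; rewrite mulr0.
  have yy : dot y y = 1.
    by rewrite dotZl dotZr Hdot expr2 mulKf ?mulVf// gt_eqF.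
  have lt_eq i : (i < N.+1)%N -> i != N -> (i < N)%N.
    by rewrite ltnS leq_eqVlt => /predU1P[->|//]; rewrite eqxx.
  exists (fun i => if i == N then y else e i); split.
  - move=> i j /= iN jN; case: (eqVneq i N) => [->|iN'].
      case: (eqVneq j N) => [_ //|jN'].
      by rewrite ye ?lt_eq.
    case: (eqVneq j N) => [->|jN'].
      by rewrite dotC ye ?lt_eq// (negbTE iN').
    by rewrite oe //= lt_eq.
  - move=> i iN; case: (eqVneq i N) => [_|/(lt_eq _ iN)]; last exact: Me.
    exact: subspaceZ.
  - move=> i iN; case: (eqVneq i N) => [_|/(lt_eq _ iN)]; last exact: le.
    rewrite symmetricZ dotZl dotZr mulrA -expr2 exprVn [leRHS]mulrC.
    by rewrite ler_pdivlMr ?exprn_gt0// ltW.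
have [K CK] : exists K : nat, 2 * C / s < K%:R.
  by exists (Num.truncn (2 * C / s)).+1; exact: truncnS_gt.
have [e [oe _ le]] := fam K.
have : \sum_(i < K) s / 2 <= C.
  by rewrite (le_trans _ (A_trace oe))//; apply: ler_sum => i _; exact: le.
rewrite sumr_const card_ord -mulr_natl => KC.
by move: CK; rewrite ltr_pdivrMr//; lra.
Qed.

(** Off the span of the dominant family A - s is bounded below, since there
    s |g|^2 - dot (A g) g >= (s / 2) |g|^2. Hence A x - s x controls x up to its
    component in a finite-dimensional space. *)
Lemma norm_le_op_shift N e x : orthonormal_on dot `I_N e ->
  (forall i, (i < N)%N -> M (e i)) ->
  (forall x, M x -> (forall i, (i < N)%N -> dot x (e i) = 0) ->
      dot (A x) x <= s / 2 * `|x| ^+ 2) ->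
  M x ->
  `|x| <= 2 / s * `|A x - s *: x| + 5 * `|partial_expansion dot `I_N e N x|.
Proof.
move=> oe Me Ae Mx; set p := partial_expansion _ _ _ _ _.
have Mp : M p by exact: subspace_partial_expansion.
pose g := x - p.
have Mg : M g by exact: subspaceB.
have gs : s / 2 * `|g| <= `|A g - s *: g|.
  have Ag : dot (A g) g <= s / 2 * `|g| ^+ 2.
    by apply: Ae => // i iN; rewrite dotBl partial_expansion_coef ?subrr.
  have [->|g0] := eqVneq g 0; first by rewrite normr0 mulr0.
  rewrite -(@ler_pM2r _ `|g|) ?normr_gt0//.
  rewrite -[s / 2 * _ * _]mulrA -expr2 (distrC (A g)).
  rewrite (le_trans _ (normr_dot_le Hdot _ _))//.
  rewrite (le_trans _ (ler_norm _))// dotBl dotZl Hdot; lra.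
have gE : A g - s *: g = (A x - s *: x) - (A p - s *: p).
  by rewrite symmetricB scalerBr !opprD !opprK addrACA.
have xg : `|x| <= `|g| + `|p| by rewrite -[x in leLHS](subrK p); exact: ler_normD.
have := ler_normB (A x - s *: x) (A p - s *: p); rewrite -gE => gE'.
have ps := norm_op_shift_le Mp.
(* Through p the shifted operator costs at most 2 s |p|, which gives 4 |p| after
   division by s / 2; the fifth |p| is that of x = g + p. *)
have : `|g| <= 2 / s * (`|A x - s *: x| + 2 * s * `|p|).
  rewrite -(@ler_pM2l _ (s / 2)) ?divr_gt0//.
  rewrite [leRHS](_ : _ = `|A x - s *: x| + 2 * s * `|p|); last first.
    by field; rewrite gt_eqF.
  lra.
rewrite mulrDr [X in _ + X](_ : _ = 4 * `|p|); last by field; rewrite gt_eqF.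
lra.
Qed.

(** A u_n - s u_n tends to 0 and, along a suitable ultrafilter, the finitely many
    coordinates of u_n on the dominant family converge. By [norm_le_op_shift]
    u_n is then Cauchy along the ultrafilter, and its limit is the
    eigenvector. *)
Lemma eigenvector_of_maximizing (u : nat -> H) :
  (forall n, M (u n)) -> (forall n, `|u n| = 1) ->
  dot (A (u n)) (u n) @[n --> \oo] --> s ->
  exists x, [/\ M x, `|x| = 1 & A x = s *: x].
Proof.
move=> Mu u1 us.
have [N [e [oe Me Ae]]] := finite_dominant_family.
have [U [UU Uoo]] := @ultraFilterLemma _ \oo _.
have coefU (i : 'I_N) : exists l : R, dot (u n) (e i) @[n --> U] --> l.
  apply: (ultra_cvg_segment (a := - `|e i|) (b := `|e i|)) => n.
  by rewrite -ler_norml (le_trans (normr_dot_le Hdot _ _))// u1 mul1r.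
have [p Pp] : exists p : H,
    partial_expansion dot `I_N e N (u n) @[n --> U] --> p.
  have /choice[l le] := coefU.
  exists (\sum_(i < N | (i : nat) \in `I_N) l i *: e i).
  under eq_fun do rewrite /partial_expansion big_mkord.
  apply: cvg_big; first exact: add_continuous.
  by move=> i _; apply: cvgZr_tmp; exact: le.
have shiftU (d : R) : 0 < d -> \forall n \near U, `|A (u n) - s *: u n| < d.
  move=> d0; apply: Uoo.
  have ds : 0 < d ^+ 2 / s by rewrite divr_gt0// exprn_gt0.
  near=> n.
  rewrite -ltr_sqr ?nnegrE// ?ltW//.
  rewrite (le_lt_trans (sqr_norm_op_shift_le (Mu n)))//.
  rewrite u1 expr1n mulr1 mulrC -ltr_pdivlMr//.
  rewrite (le_lt_trans (ler_norm _))//; near: n.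
  exact: (cvgrPdist_lt _ _).1 us _ ds.
have cu : cvg (u n @[n --> U]).
  apply: cauchy_cvg; apply: cauchy_exP => eps eps0.
  (* In the bound of [norm_le_op_shift] for a difference u_k - u_n both terms are
     then at most eps / 2. *)
  have d0 : 0 < s * eps / 8 by rewrite divr_gt0// mulr_gt0.
  have h0 : 0 < eps / 20 by rewrite divr_gt0.
  pose G := [set n | `|A (u n) - s *: u n| < s * eps / 8 /\
    `|p - partial_expansion dot `I_N e N (u n)| < eps / 20].
  have UG : U G.
    by apply: filterI; [exact: shiftU|exact: (cvgrPdist_lt _ _).1 Pp _ h0].
  have [k [k1 k2]] := filter_ex UG.
  exists (u k).
  suff : \forall n \near U, ball (u k) eps (u n) by [].
  apply: filterS UG => n [n1 n2]; rewrite -ball_normE/=.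
  apply: le_lt_trans (norm_le_op_shift oe Me Ae (subspaceB (Mu k) (Mu n))) _.
  rewrite partial_expansionB.
  have := ler_distD p (partial_expansion dot `I_N e N (u k))
    (partial_expansion dot `I_N e N (u n)).
  rewrite (distrC _ p) => h1.
  have h2 : `|A (u k - u n) - s *: (u k - u n)| <=
      `|A (u k) - s *: u k| + `|A (u n) - s *: u n|.
    rewrite symmetricB scalerBr opprD opprK addrACA (addrC (- A (u n))).
    by rewrite (le_trans (ler_normD _ _))// (distrC (s *: u n)).
  have : 2 / s * `|A (u k - u n) - s *: (u k - u n)| <= 2 / s * (s * eps / 4).
    by rewrite ler_pM2l ?divr_gt0//; lra.
  rewrite [X in _ <= X -> _](_ : _ = eps / 2); last by field; rewrite gt_eqF.
  lra.
set x := lim (u n @[n --> U]).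
have ux : u n @[n --> U] --> x by [].
have Mx : M x.
  by apply: (closed_cvg _ M_closed _ _ ux); exact: filterE.
exists x; split => //.
  have h : `|u n| @[n --> U] --> `|x| by exact: cvg_norm.
  have h1 : `|u n| @[n --> U] --> (1 : R).
    by under eq_fun do rewrite u1; exact: cvg_cst.
  exact: cvg_unique h h1.
apply/eqP; rewrite -subr_eq0 -normr_le0; apply/ler_addgt0Pl => eps eps0.
rewrite addr0.
have d0 : 0 < eps / (4 * s) by rewrite divr_gt0// mulr_gt0.
have e2 : 0 < eps / 2 by rewrite divr_gt0.
have [k [k1 k2]] := filter_ex (filterI (shiftU _ e2) ((cvgrPdist_lt _ _).1 ux _ d0)).
have := norm_op_shift_le (subspaceB Mx (Mu k)).
have : 2 * s * `|x - u k| <= eps / 2.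
  rewrite (_ : eps / 2 = 2 * s * (eps / (4 * s))); last by field; rewrite gt_eqF.
  by rewrite ler_pM2l ?mulr_gt0// ltW.
have := ler_normD (A (x - u k) - s *: (x - u k)) (A (u k) - s *: u k).
rewrite addrACA -symmetricD -opprD -scalerDr !subrK.
lra.
Unshelve. all: by end_near. Qed.

End positive_operator.

Section eigenvector.
Context (R : realType) (H : completeNormedModType R) (dot : {dot H for idfun}).
Hypothesis Hdot : induces_norm dot.

(** The eigenvalue is the supremum of the form on the unit sphere of M, finite
    by the trace bound for families of one vector. *)
Lemma exists_eigenvector (A : H -> H) (M : set H) (C : R) :
  (forall x y, dot (A x) y = dot x (A y)) ->
  (forall x, 0 <= dot (A x) x) ->
  (forall N e, orthonormal_on dot `I_N e ->
    \sum_(i < N) dot (A (e i)) (e i) <= C) ->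
  (forall a x y, M x -> M y -> M (a *: x + y)) -> closed M ->
  (forall x, M x -> M (A x)) ->
  (exists2 x, M x & dot (A x) x != 0) ->
  exists s x, [/\ 0 < s, M x, `|x| = 1 & A x = s *: x].
Proof.
move=> A_sym A_pos A_trace M_lin M_closed M_inv [x0 Mx0 x0N].
pose E := [set dot (A x) x | x in [set x | M x /\ `|x| = 1]].
have A_C x : dot (A x) x <= C * `|x| ^+ 2.
  have [->|xN] := eqVneq x 0; first by rewrite dot0r normr0 expr0n mulr0.
  have x_gt0 : 0 < `|x| by rewrite normr_gt0.
  have o : orthonormal_on dot `I_1 (fun=> `|x|^-1 *: x).
    move=> [|//] [|//] _ _.
    by rewrite dotZl dotZr Hdot expr2 mulKf ?mulVf// gt_eqF.
  have := A_trace _ _ o.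
  rewrite big_ord1 (symmetricZ Hdot A_sym) dotZl dotZr mulrA -expr2 exprVn [leLHS]mulrC.
  by rewrite ler_pdivrMr// exprn_gt0.
have E_norm x : M x -> x != 0 -> E (dot (A x) x / `|x| ^+ 2).
  move=> Mx xN; exists (`|x|^-1 *: x).
    split; first exact: subspaceZ.
    by rewrite normrZ normfV normr_id mulVf// normr_eq0.
  by rewrite (symmetricZ Hdot A_sym) dotZl dotZr mulrA -expr2 exprVn mulrC.
have x00 : x0 != 0 by apply: contraNneq x0N => ->; rewrite dot0r.
have sE : has_sup E.
  split; first by exists (dot (A x0) x0 / `|x0| ^+ 2); exact: E_norm.
  by exists C => _ [x [_ x1] <-]; have := A_C x; rewrite x1 expr1n mulr1.
have A_le x : M x -> dot (A x) x <= sup E * `|x| ^+ 2.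
  move=> Mx; have [->|xN] := eqVneq x 0; first by rewrite dot0r normr0 expr0n/= mulr0.
  rewrite -ler_pdivrMr ?exprn_gt0 ?normr_gt0//.
  by apply: sup_ubound; [case: sE|exact: E_norm].
have s0 : 0 < sup E.
  have h : 0 < dot (A x0) x0 by rewrite lt_neqAle eq_sym x0N A_pos.
  have := lt_le_trans h (A_le _ Mx0).
  by rewrite pmulr_lgt0// exprn_gt0// normr_gt0.
have [v [Ev vs]] := sup_sequence sE.
have /choice[u uv] : forall n, exists x, [/\ M x, `|x| = 1 & dot (A x) x = v n].
  by move=> n; have [x [Mx x1] xv] := Ev n; exists x.
have [||//|x [Mx x1 Ax]] := @eigenvector_of_maximizing _ _ _ Hdot _ A_sym A_pos
  _ M_lin M_closed M_inv _ s0 A_le _ A_trace u.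
- by move=> n; have [] := uv n.
- by move=> n; have [] := uv n.
- by rewrite (_ : (fun n => _) = v)//; apply/funext => n; have [] := uv n.
by exists (sup E), x.
Qed.

End eigenvector.

(** * Multiplicities *)

Section multiplicity.
Context (R : realType) (H : normedModType R) (dot : {dot H for idfun}).

(** The matrix of the coefficients of the v_i on the e_j has more rows than
    columns when k < m, so a nontrivial combination of the v_i vanishes. *)
Lemma orthonormal_span_leq k m (e : 'I_k -> H) (v : nat -> H) :
  orthonormal_on dot `I_m v ->
  (forall i, (i < m)%N -> exists c : 'I_k -> R, v i = \sum_j c j *: e j) ->
  (m <= k)%N.
Proof.
move=> ov ve; rewrite leqNgt; apply/negP => km.
have /choice[c cE] : forall i : 'I_m, exists c : 'I_k -> R,
    v i = \sum_j c j *: e j by move=> i; exact: ve.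
pose B := \matrix_(i < m, j < k) c i j.
have : kermx B != 0.
  rewrite kermx_eq0 /row_free neq_ltn; apply/orP; left.
  exact: leq_ltn_trans (rank_leq_col B) km.
case/rowV0Pn => a /sub_kermxP aB a0.
have av0 : \sum_i a 0 i *: v i = 0.
  under eq_bigr do rewrite cE scaler_sumr.
  rewrite exchange_big/= big1// => j _.
  have h : \sum_i a 0 i * c i j = 0.
    transitivity ((a *m B) 0 j); last by rewrite aB mxE.
    by rewrite mxE; apply: eq_bigr => i _; rewrite mxE.
  by under eq_bigr do rewrite scalerA; rewrite -scaler_suml h scale0r.
move/eqP: a0; apply; apply/rowP => i; rewrite mxE.
have : dot (\sum_i a 0 i *: v i) (v i) = 0 by rewrite av0 dot0l.
rewrite dot_suml (bigD1 i)//= dotZl ov//= eqxx mulr1 big1 ?addr0// => j ji.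
by rewrite dotZl ov//= (_ : (j == i :> nat) = false) ?mulr0//; exact/negbTE.
Qed.

Hypothesis Hdot : induces_norm dot.
Variables (A : H -> H) (lam : nat -> R) (phi : nat -> H) (C : R).
Hypothesis A_trace : forall N e, orthonormal_on dot `I_N e ->
  \sum_(i < N) dot (A (e i)) (e i) <= C.
Hypothesis Hlam : eigenvalue_sequence A lam.
Hypothesis Hphi : orthonormal_eigenvectors dot A lam phi.
Let J := index_set A.

(** Infinitely many orthonormal eigenvectors for the same mu > 0 would give
    families of trace K mu for every K. *)
Lemma finite_multiplicity (mu : R) : 0 < mu -> finite_set [set j | J j /\ lam j = mu].
Proof.
move=> mu0; apply: contrapT => /infiniteP/pcard_leP[f].
have [ophi Aphi] := Hphi.
have fJ i : J (f i) /\ lam (f i) = mu by exact: (@funS _ _ _ _ f).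
have of_ N : orthonormal_on dot `I_N (phi \o f).
  move=> i j _ _ /=; rewrite (ophi _ _ (fJ i).1 (fJ j).1); congr (_%:R).
  congr nat_of_bool; by apply/eqP/eqP => [fij|->//]; apply: (@inj _ _ _ f); rewrite ?inE.
have [K CK] : exists K : nat, C / mu < K%:R.
  by exists (Num.truncn (C / mu)).+1; exact: truncnS_gt.
have : \sum_(i < K) mu <= C.
  rewrite (le_trans _ (A_trace (of_ K)))//; apply: ler_sum => i _ /=.
  have [Ji li] := fJ i.
  by rewrite (Aphi _ Ji) dotZl (ophi _ _ Ji Ji) eqxx mulr1 li.
rewrite sumr_const card_ord -mulr_natl => KC.
by move: CK; rewrite ltr_pdivrMr// ltNge KC.
Qed.

(** Together with the k vectors phi_j listed for mu, where k is the dimension of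
    the eigenspace, x would make k + 1 orthonormal vectors of that eigenspace.
    *)
Lemma no_eigenvector_orthogonal (mu : R) x : 0 < mu -> `|x| = 1 -> A x = mu *: x ->
  ~ (forall j, J j -> dot x (phi j) = 0).
Proof.
move=> mu0 x1 Ax xphi; have [ophi Aphi] := Hphi; have [_ _ mult] := Hlam.
have [k Kk] := finite_multiplicity mu0.
have [e [_ eE]] := (mult mu k (lt0r_neq0 mu0)).2 Kk.
move: Kk; rewrite card_eq_le => /andP[_ /pcard_leP[f]].
have fJ i : (i < k)%N -> J (f i) /\ lam (f i) = mu.
  by move=> ik; exact: (@funS _ _ _ _ f).
have lt_neq i : (i < k.+1)%N -> i != k -> (i < k)%N.
  by rewrite ltnS leq_eqVlt => /predU1P[->|//]; rewrite eqxx.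
suff : (k.+1 <= k)%N by rewrite ltnn.
apply: (@orthonormal_span_leq _ _ e (fun i => if i == k then x else phi (f i))).
  move=> i j /= ik jk; case: (eqVneq i k) => [->|ik'].
    case: (eqVneq j k) => [_|jk']; first by rewrite Hdot x1 expr1n.
    by rewrite (xphi _ (fJ j (lt_neq _ jk jk')).1).
  case: (eqVneq j k) => [->|jk'].
    by rewrite dotC (xphi _ (fJ i (lt_neq _ ik ik')).1) (negbTE ik').
  have {}ik := lt_neq _ ik ik'; have {}jk := lt_neq _ jk jk'.
  rewrite (ophi _ _ (fJ i ik).1 (fJ j jk).1); congr (_%:R).
  by congr nat_of_bool; apply/eqP/eqP => [fij|->//]; apply: (@inj _ _ _ f); rewrite ?inE.
move=> i ik; suff : eigenspace_of A mu (if i == k then x else phi (f i)).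
  by rewrite eE.
rewrite /eigenspace_of/=; case: (eqVneq i k) => [//|ik'].
by have [Ji li] := fJ i (lt_neq _ ik ik'); rewrite Aphi// li.
Qed.

End multiplicity.

Section complement.
Context (R : realType) (H : completeNormedModType R) (dot : {dot H for idfun}).
Hypothesis Hdot : induces_norm dot.
Variables (A : H -> H) (lam : nat -> R) (phi : nat -> H) (C : R).
Hypothesis A_sym : forall x y, dot (A x) y = dot x (A y).
Hypothesis A_pos : forall x, 0 <= dot (A x) x.
Hypothesis A_trace : forall N e, orthonormal_on dot `I_N e ->
  \sum_(i < N) dot (A (e i)) (e i) <= C.
Hypothesis Hlam : eigenvalue_sequence A lam.
Hypothesis Hphi : orthonormal_eigenvectors dot A lam phi.
Let J := index_set A.

(** Completeness of the eigenvectors: the complement of the phi_j is closed and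
    invariant under A, and a nonzero form on it would produce an eigenvector
    there, which [no_eigenvector_orthogonal] excludes. *)
Lemma form_eq0_on_complement x : (forall j, J j -> dot x (phi j) = 0) ->
  dot (A x) x = 0.
Proof.
move=> xphi; apply/eqP/negPn/negP => Ax0.
pose M := [set y | forall j, J j -> dot y (phi j) = 0].
have [||||s [y [s0 My y1 Ay]]] := exists_eigenvector Hdot A_sym A_pos A_trace (M := M).
- by move=> a y z My Mz j Jj; rewrite dotDl dotZl My// Mz// mulr0 addr0.
- rewrite (_ : M = \bigcap_(j in J) ((dot^~ (phi j)) @^-1` [set 0])).
    apply: closed_bigI => j Jj; apply: preimage_closed.
      by move=> y _; exact: continuous_dot.
    exact: closed_eq.
  by rewrite eqEsubset; split.
- move=> y My j Jj; rewrite A_sym; have [_ ->//] := Hphi.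
  by rewrite dotZr My// mulr0.
- by exists x.
exact: (no_eigenvector_orthogonal Hdot A_trace Hlam Hphi s0 y1 Ay My).
Qed.

End complement.

(** * Second moments of a random element *)

Section countable_ae.
Context d (T : measurableType d) (R : realType) (mu : {measure set T -> \bar R}).

Lemma ae_forall_countable (U : Type) (D : set U) (Q : U -> T -> Prop) :
  countable D -> (forall x, D x -> {ae mu, forall w, Q x w}) ->
  {ae mu, forall w, forall x, D x -> Q x w}.
Proof.
move=> /pcard_leP[f] Qae.
have : {ae mu, forall w, forall n, forall x, D x -> f x = n -> Q x w}.
  apply: ae_foralln => n.
  have [[x [Dx fx]]|nox] := pselect (exists x, D x /\ f x = n).
    apply: filterS (Qae x Dx) => w Qxw y Dy fy.
    suff -> : y = x by [].
    by apply: (@inj _ _ D f); [exact: mem_set|exact: mem_set|exact: etrans fy (esym fx)].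
  by apply: aeW => w x Dx fx; case: nox; exists x.
by apply: filterS => w Qw x Dx; exact: Qw (erefl (f x)).
Qed.

End countable_ae.

Section random_element.
Context (R : realType) (H : normedModType R).
Context d (T : measurableType d) (P : probability T R).
Implicit Types X : T -> H.

Lemma random_element_preimage X (B : set H) :
  random_element X -> open B -> measurable (X @^-1` B).
Proof.
by move=> mX oB; rewrite -[_ @^-1` _]setTI; apply: mX => //; exact: sub_sigma_algebra.
Qed.

Lemma random_element_continuous (F : H -> H) X :
  continuous F -> random_element X -> random_element (F \o X).
Proof.
move=> /continuousP cF mX.
apply: (@measurability _ _ _ (g_sigma_algebraType (@open H)) _ _ (@open H)) => //.
by move=> _ [B oB <-]; rewrite setTI comp_preimage; apply: random_element_preimage => //; exact: cF.
Qed.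

Lemma measurable_fun_continuous_comp (F : H -> R) X :
  continuous F -> random_element X -> measurable_fun setT (F \o X).
Proof.
move=> /continuousP cF mX.
apply: (measurability _ (RGenOpens.measurableE R)) => _ [_ [a [b ->]] <-].
rewrite setTI comp_preimage; apply: random_element_preimage => //; apply: cF.
exact: interval_open.
Qed.

Lemma measurable_sqr_norm X :
  random_element X -> measurable_fun setT (fun w => (`|X w| ^+ 2)%:E).
Proof.
move=> mX; apply/measurable_EFinP; apply: measurable_funX.
apply: (measurable_fun_continuous_comp (F := fun x => `|x|)) => //.
exact: norm_continuous.
Qed.

Lemma integrable_sqr_norm X :
  strong_second_order P X -> P.-integrable setT (EFin \o (fun w => `|X w| ^+ 2)).
Proof.
move=> [mX]; rewrite unlock => X2; apply/integrableP.
split; first exact: measurable_sqr_norm.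
by under eq_integral do rewrite /= ger0_norm ?sqr_ge0//.
Qed.

Lemma strong_second_order_le X (Y : T -> H) : strong_second_order P X -> random_element Y ->
  (forall w, `|Y w| <= `|X w|) -> strong_second_order P Y.
Proof.
move=> sX mY YX; split => //; have [mX] := sX; rewrite unlock.
apply: le_lt_trans; apply: ge0_le_integral => //; [exact: measurable_sqr_norm..|].
by move=> w _; rewrite lee_fin ler_sqr ?nnegrE.
Qed.

End random_element.

Section covariance.
Context (R : realType) (H : completeNormedModType R) (dot : {dot H for idfun}).
Hypothesis Hdot : induces_norm dot.
Context d (T : measurableType d) (P : probability T R).
Variable xi : T -> H.
Hypothesis Hxi : strong_second_order P xi.
Local Notation A := (covariance_operator dot P xi).

Lemma measurable_dot h : measurable_fun setT (fun w => dot (xi w) h).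
Proof.
apply: (measurable_fun_continuous_comp (F := dot^~ h)); last by case: Hxi.
by move=> x; exact: continuous_dot.
Qed.

Lemma integrable_dot_mul h f :
  P.-integrable setT (EFin \o (fun w => dot (xi w) h * dot (xi w) f)).
Proof.
apply: (@le_integrable _ _ _ P _ measurableT _ (EFin \o (fun w => `|h| * `|f| * `|xi w| ^+ 2))).
- by apply/measurable_EFinP; apply: measurable_funM; exact: measurable_dot.
- move=> w _ /=; rewrite lee_fin normrM [leRHS]ger0_norm ?mulr_ge0 ?sqr_ge0//.
  rewrite (_ : _ * _ * _ = `|xi w| * `|h| * (`|xi w| * `|f|)); last by ring.
  by apply: ler_pM => //; exact: normr_dot_le.
- apply: eq_integrable (integrableZl measurableT (`|h| * `|f|) (integrable_sqr_norm Hxi)) => //.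
Qed.

(** The mean defining A h exists by the Riesz representation of
    f |-> E <xi, h> <xi, f>, which |h| E |xi|^2 bounds; so the default value of
    [mean] is never reached. *)
Lemma covariance_operatorE h f :
  (\int[P]_w (dot (xi w) h * dot (xi w) f)%:E = (dot (A h) f)%:E)%E.
Proof.
pose l f := \int[P]_w (dot (xi w) h * dot (xi w) f).
have lE f' : (\int[P]_w (dot (xi w) h * dot (xi w) f')%:E)%E = (l f')%:E.
  by rewrite fineK//; exact: integrable_fin_num (integrable_dot_mul h f').
have [||m lm] := @riesz_representation _ _ _ Hdot l
    (`|h| * \int[P]_w (`|xi w| ^+ 2)).
- move=> a x y; rewrite /l -RintegralZl//; last exact: integrable_dot_mul.
  rewrite -RintegralD//.
  + by congr fine; apply: eq_integral => w _; rewrite dotDr dotZr; congr EFin; ring.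
  + apply: eq_integrable (integrableZl measurableT a (integrable_dot_mul h x)) => //.
  + exact: integrable_dot_mul.
- move=> f'; rewrite (le_trans (le_normr_Rintegral _ (integrable_dot_mul h f')))//.
  rewrite mulrAC -RintegralZl//; last exact: integrable_sqr_norm.
  apply: le_Rintegral => //.
  + apply: eq_integrable (integrable_abse (integrable_dot_mul h f')) => //.
  + apply: eq_integrable (integrableZl measurableT (`|h| * `|f'|) (integrable_sqr_norm Hxi)) => //.
  + move=> w _; rewrite normrM.
    rewrite (_ : _ * _ * _ = `|xi w| * `|h| * (`|xi w| * `|f'|)); last by ring.
    by apply: ler_pM => //; exact: normr_dot_le.
have : is_mean dot P (fun w => dot (xi w) h *: xi w) (A h).
  apply: xgetPex; exists m => f'; rewrite unlock -lm -lE.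
  by apply: eq_integral => w _; rewrite dotZl.
move=> /(_ f) <-; rewrite unlock.
by apply: eq_integral => w _; rewrite dotZl.
Qed.

Lemma expectation_dot_mul h f :
  ('E_P[fun w => (dot (xi w) h * dot (xi w) f)%R] = (dot (A h) f)%:E)%E.
Proof. by rewrite unlock covariance_operatorE. Qed.

Lemma covariance_operator_sym x y : dot (A x) y = dot x (A y).
Proof.
apply: EFin_inj; rewrite (dotC dot x) -!covariance_operatorE.
by apply: eq_integral => w _; rewrite mulrC.
Qed.

Lemma covariance_operator_ge0 x : 0 <= dot (A x) x.
Proof.
rewrite -lee_fin -covariance_operatorE; apply: integral_ge0 => w _.
by rewrite lee_fin -expr2 sqr_ge0.
Qed.

(** Bessel's inequality for xi w, integrated over w. *)
Lemma covariance_operator_trace N e : orthonormal_on dot `I_N e ->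
  \sum_(i < N) dot (A (e i)) (e i) <= \int[P]_w (`|xi w| ^+ 2).
Proof.
move=> oe; rewrite -lee_fin fineK; last first.
  exact: integrable_fin_num (integrable_sqr_norm Hxi).
rewrite -sumEFin; under eq_bigr do rewrite -covariance_operatorE.
rewrite -(@integral_sum _ _ _ P _ measurableT _
  (fun i : 'I_N => EFin \o (fun w => dot (xi w) (e i) * dot (xi w) (e i)))); last first.
  by move=> i; exact: integrable_dot_mul.
under eq_integral do rewrite sumEFin.
apply: ge0_le_integral => //.
- by move=> w _; rewrite lee_fin sumr_ge0// => i _; rewrite -expr2 sqr_ge0.
- apply/measurable_EFinP; apply: measurable_sum => i.
  by apply: measurable_funM; exact: measurable_dot.
- by case/integrableP: (integrable_sqr_norm Hxi).
- move=> w _; rewrite lee_fin (le_trans _ (bessel_inequality Hdot oe N _))//.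
  rewrite dot_partial_expansion big_mkord.
  rewrite [leRHS](_ : _ = \sum_(i < N) dot (xi w) (e i) ^+ 2)//.
  by apply: eq_bigl => i; rewrite mem_set//=; exact: ltn_ord.
Qed.

(** dot (A h) h is the second moment of dot xi h. *)
Lemma ae_dot_eq0 h : dot (A h) h = 0 -> {ae P, forall w, dot (xi w) h = 0}.
Proof.
move=> Ah0.
have mh2 : measurable_fun setT (fun w => (dot (xi w) h * dot (xi w) h)%:E).
  by apply/measurable_EFinP; apply: measurable_funM; exact: measurable_dot.
have : (\int[P]_w `|(dot (xi w) h * dot (xi w) h)%:E| = 0)%E.
  rewrite -[RHS](_ : (dot (A h) h)%:E = 0%E); last by rewrite Ah0.
  rewrite -covariance_operatorE; apply: eq_integral => w _.
  by rewrite gee0_abs// lee_fin -expr2 sqr_ge0.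
move=> /(ae_eq_integral_abs P measurableT mh2).
apply: filterS => w /(_ I)[] /eqP.
by rewrite mulf_eq0 orbb => /eqP.
Qed.

End covariance.

(** * The expansion *)

Section karhunen_loeve.
Context (R : realType) (H : completeNormedModType R) (dot : {dot H for idfun}).
Hypothesis Hdot : induces_norm dot.

Lemma dense_dot_eq0 (D : set H) y : dense D ->
  (forall x, D x -> dot y x = 0) -> y = 0.
Proof.
move=> dD yD; apply/eqP/negPn/negP; rewrite -normr_gt0 => y0.
have [||x [yx Dx]] := dD (ball y `|y|).
- by exists y; exact: ballxx.
- exact: ball_open.
have : `|y| ^+ 2 <= `|y| * `|y - x|.
  rewrite -Hdot -[leLHS]subr0 -(yD x Dx) -dotBr.
  by rewrite (le_trans (ler_norm _))// normr_dot_le.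
rewrite expr2 ler_pM2l// leNgt => /negP; apply.
by move: yx; rewrite -ball_normE.
Qed.

Lemma continuous_partial_expansion J e n : orthonormal_on dot J e ->
  continuous (partial_expansion dot J e n).
Proof.
move=> oe x; apply/cvgrPdist_lt => eps eps0.
have : \forall y \near x, `|x - y| < eps.
  exact: (cvgrPdist_lt _ _).1 (@cvg_id _ (nbhs x)) _ eps0.
apply: filterS => y; apply: le_lt_trans.
by rewrite -partial_expansionB norm_partial_expansion_le.
Qed.

Context d (T : measurableType d) (P : probability T R).
Variable xi : T -> H.
Hypothesis Hxi : strong_second_order P xi.

(** The finite second moments make [L2norm] a square root of reals. *)
Lemma L2norm_cvg0 (X : nat -> T -> H) : (forall n, strong_second_order P (X n)) ->
  ('E_P[fun w => (`|X n w| ^+ 2)%R])%E @[n --> \oo] --> 0%E ->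
  L2norm P (X n) @[n --> \oo] --> 0%E.
Proof.
move=> sX X0; pose r n := fine ('E_P[fun w => (`|X n w| ^+ 2)%R])%E.
have rE n : ('E_P[fun w => (`|X n w| ^+ 2)%R])%E = (r n)%:E.
  rewrite fineK// ge0_fin_numE; first by have [] := sX n.
  by apply: expectation_ge0 => w; exact: sqr_ge0.
have r0 : r n @[n --> \oo] --> 0 by apply: fine_cvg.
have r_ge0 n : 0 <= r n.
  by rewrite fine_ge0//; apply: expectation_ge0 => w; exact: sqr_ge0.
rewrite (_ : (fun n => _) = EFin \o (fun n => Num.sqrt (r n))).
  apply/cvg_EFin; first exact: nearW.
  rewrite -[0](@sqrtr0 R); apply: continuous_cvg => //; exact: sqrt_continuous.
by apply/funext => n; rewrite /L2norm rE poweR_EFin powR12_sqrt.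
Qed.

(** Dominated convergence: by Pythagoras |S_n xi - xi|^2 never exceeds
    |xi|^2. *)
Lemma cvg_L2_partial_expansion J e : orthonormal_on dot J e ->
  {ae P, forall w, partial_expansion dot J e n (xi w) @[n --> \oo] --> xi w} ->
  cvg_L2 P (fun n w => partial_expansion dot J e n (xi w)) xi.
Proof.
move=> oe xiE; have [mxi _] := Hxi.
pose S := partial_expansion dot J e.
have sub_le x n : `|S n x - x| <= `|x|.
  rewrite -ler_sqr ?nnegrE// distrC (sqr_norm_subr_partial_expansion Hdot oe).
  by rewrite gerBl -(sqr_norm_partial_expansion Hdot oe) sqr_ge0.
have sS n : strong_second_order P (fun w => S n (xi w)).
  apply: strong_second_order_le Hxi _ _ => [|w].
    by apply: random_element_continuous => //; exact: continuous_partial_expansion.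
  exact: norm_partial_expansion_le.
have sB n : strong_second_order P (fun w => S n (xi w) - xi w).
  apply: strong_second_order_le Hxi _ _ => [|w]; last exact: sub_le.
  apply: (@random_element_continuous _ _ _ _ (fun x => S n x - x)) => // x.
  by apply: cvgB; [exact: continuous_partial_expansion|exact: cvg_id].
split => //; apply: L2norm_cvg0 => //.
rewrite (_ : (fun n => _) =
  fun n => (\int[P]_w (`|S n (xi w) - xi w| ^+ 2)%:E)%E); last first.
  by apply/funext => n; rewrite unlock.
have [] := @dominated_convergence _ _ _ P setT measurableT
  (fun n w => (`|S n (xi w) - xi w| ^+ 2)%:E) (cst 0%E)
  (fun w => (`|xi w| ^+ 2)%:E).
- by move=> n; apply: measurable_sqr_norm; case: (sB n).
- exact: measurable_cst.
- apply: filterS xiE => w wE _; apply/cvg_EFin; first exact: nearW.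
  rewrite /comp/= [X in _ --> X](_ : _ = `|xi w - xi w| * `|xi w - xi w|); last first.
    by rewrite subrr normr0 mulr0.
  under eq_fun do rewrite expr2.
  by apply: cvgM; apply: cvg_norm; apply: cvgB => //; exact: cvg_cst.
- exact: integrable_sqr_norm.
- apply: aeW => w n _; rewrite gee0_abs ?lee_fin ?sqr_ge0//.
  by rewrite ler_sqr ?nnegrE.
by rewrite integral0.
Qed.

(** xi being centered, the covariance is the expectation of the product. *)
Lemma covariance_dot x y : centered dot P xi ->
  covariance P (fun w => dot (xi w) x) (fun w => dot (xi w) y) =
  (dot (covariance_operator dot P xi x) y)%:E.
Proof.
move=> Hcent; rewrite -(covariance_operatorE Hdot Hxi) covariance.unlock.
rewrite !Hcent !dot0l unlock; apply: eq_integral => w _ /=.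
by rewrite /GRing.mul/= !subr0.
Qed.

(** For each x the remainder x - S x is orthogonal to the phi_j, so dot xi
    (x - S x) has second moment 0. As S is symmetric this number is also
    dot (xi - S xi) x; the exceptional sets of a countable dense set of x have
    null union, and off it xi - S xi is orthogonal to a dense set. *)
Lemma ae_cvg_partial_expansion (lam : nat -> R) (phi : nat -> H) :
  separable_space H ->
  eigenvalue_sequence (covariance_operator dot P xi) lam ->
  orthonormal_eigenvectors dot (covariance_operator dot P xi) lam phi ->
  {ae P, forall w, partial_expansion dot
    (index_set (covariance_operator dot P xi)) phi n (xi w) @[n --> \oo]
    --> xi w}.
Proof.
move=> [D cD dD] Hlam Hphi; have [oe _] := Hphi.
set J := index_set _ in oe *.
pose S := expansion dot J phi.
have : {ae P, forall w, forall x, D x -> dot (xi w) (x - S x) = 0}.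
  apply: ae_forall_countable => // x _; apply: (ae_dot_eq0 Hdot Hxi).
  apply: (form_eq0_on_complement Hdot (covariance_operator_sym Hdot Hxi)
    (covariance_operator_ge0 Hdot Hxi) (covariance_operator_trace Hdot Hxi) Hlam Hphi).
  by move=> j Jj; rewrite dotBl (expansion_coef Hdot oe)// subrr.
apply: filterS => w wD.
have SE : S (xi w) = xi w.
  apply/esym/eqP; rewrite -subr_eq0; apply/eqP; apply: (dense_dot_eq0 dD) => x Dx.
  by rewrite dotBl (expansion_sym Hdot oe) -dotBr wD.
by have := @cvg_expansion _ _ _ Hdot _ _ oe (xi w); rewrite -/S SE.
Qed.

End karhunen_loeve.

Theorem corollary1 (R : realType) (H : completeNormedModType R)
  (dot : {dot H for idfun}) (Hdot : induces_norm dot)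
  (Hsep : separable_space H)
  (d : measure_display) (T : measurableType d) (P : probability T R)
  (HP : measure_is_complete P)
  (xi : T -> H) (Hxi : strong_second_order P xi) (Hcent : centered dot P xi)
  (lam : nat -> R) (phi : nat -> H)
  (Hlam : eigenvalue_sequence (covariance_operator dot P xi) lam)
  (Hphi : orthonormal_eigenvectors dot (covariance_operator dot P xi) lam phi) :
  let J := index_set (covariance_operator dot P xi) in
  [/\ {ae P, forall w,
        partial_expansion dot J phi n (xi w) @[n --> \oo] --> xi w},
      cvg_L2 P (fun n w => partial_expansion dot J phi n (xi w)) xi,
      forall i j, J i -> J j -> i <> j ->
        covariance P (fun w => dot (xi w) (phi i))
                     (fun w => dot (xi w) (phi j)) = 0%E &
      forall j, J j -> ('E_P[fun w => (dot (xi w) (phi j) ^+ 2)%R] = (lam j)%:E)%E].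

Proof.
move=> J; have [oe Ae] := Hphi.
have xiE := ae_cvg_partial_expansion Hdot Hxi Hsep Hlam Hphi.
split => //.
- exact: cvg_L2_partial_expansion.
- move=> i j Ji Jj /eqP/negbTE ij; rewrite (covariance_dot Hdot Hxi)//.
  by rewrite Ae// dotZl oe// ij mulr0.
- move=> j Jj; have := expectation_dot_mul Hdot Hxi (phi j) (phi j).
  by rewrite Ae// dotZl oe// eqxx mulr1.
Qed.
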